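(* Let $\mu/\nu$ be a skew shape of length at most $n-1$, let $N=|\mu/\nu|$, and let $\theta\vdash N$. If $\Gamma^\theta_{\mu/\nu}=\sum_i\Gamma^{(N)}_{\mu_i/\nu_i}$ as characters of $S_{n-1}$, for a finite family of skew shapes $\mu_i/\nu_i$ of size $N$ and length at most $n-1$, then $\Gamma^\theta_{\mu/\nu}=\sum_i\Gamma^{(N)}_{\mu_i/\nu_i}$ as characters of $S_n$. In particular, if every immanant character $\Gamma^\theta_{\mu/\nu}$ of $S_{\ell(\mu/\nu)}$ is a non-negative integral sum of Stanley-Stembridge characters, then every immanant character $\Gamma^\theta_{\mu/\nu}$ of $S_m$ with $m\ge\ell(\mu/\nu)$ is a non-negative integral sum of Stanley-Stembridge characters.
   Context: Partitions are weakly decreasing sequences of positive integers, extended by zeros when needed ($\nu$ may be empty). A skew shape $\mu/\nu$ is a pair of partitions with $\nu_i\le\mu_i$ for all $i$; its length $\ell(\mu/\nu)$ is the largest $i$ with $\nu_i<\mu_i$, and its size is $|\mu/\nu|=\sum_i(\mu_i-\nu_i)$. (In the claim $\mu_i/\nu_i$ denotes the $i$-th member of a family of skew shapes.) For $\theta\vdash N$ and an integer sequence $c=(c_1,\ldots,c_m)$ summing to $N$, the Kostka number $K_{\theta,c}$ is the number of semistandard Young tableaux of shape $\theta$ with content $c$; it is $0$ if some $c_i<0$. For each $m\ge\ell(\mu/\nu)$ the immanant character $\Gamma^\theta_{\mu/\nu}$ can be considered as a function on $S_m$: let $\delta=(m-1,\ldots,1,0)$, regard $\mu,\nu$ as their first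 $m$ entries, let $w\in S_m$ act by $w(a_1,\ldots,a_m)=(a_{w^{-1}(1)},\ldots,a_{w^{-1}(m)})$, and set, for $\theta\vdash N=|\mu/\nu|$, $$\Gamma^\theta_{\mu/\nu}(w)=\frac{m!}{|C(w)|}\sum_{w'\in C(w)}K_{\theta,\ \mu+\delta-w'(\nu+\delta)},$$ where $C(w)$ is the conjugacy class of $w$ in $S_m$. A Stanley-Stembridge character of $S_m$ is an immanant character $\Gamma^{(M)}_{\alpha/\beta}$ of $S_m$ with $\alpha/\beta$ a skew shape of length at most $m$ and $M=|\alpha/\beta|$ (the one-row partition $(M)$; $M$ may vary among summands). *)

(* Defs.v *)
From HB Require Import structures.
From mathcomp Require Export all_boot all_order all_algebra all_fingroup.
From mathcomp Require Export all_solvable all_field all_character.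

Set Implicit Arguments.
Unset Strict Implicit.
Unset Printing Implicit Defensive.

Import GroupScope GRing.Theory.
Local Open Scope ring_scope.

(* Sequences are 0-indexed: the i-th part (i >= 1) is [nth 0%N s i.-1]. *)
Definition is_partition (s : seq nat) : bool :=
  sorted geq s && (0%N \notin s).

Definition partition_of (N : nat) (s : seq nat) : bool :=
  is_partition s && (sumn s == N).

Definition is_skew (mu nu : seq nat) : Prop :=
  [/\ is_partition mu, is_partition nu
    & forall i : nat, (nth 0%N nu i <= nth 0%N mu i)%N].

(* 0 when mu = nu *)
Definition skew_length (mu nu : seq nat) : nat :=
  (\max_(i < size mu | nth 0 nu i < nth 0 mu i) i.+1)%N.

Definition skew_size (mu nu : seq nat) : nat :=
  (\sum_(i < size mu) (nth 0 mu i - nth 0 nu i))%N.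

(* The one-row partition (N); for N = 0 it is the empty partition. *)
Definition one_row (N : nat) : seq nat := if N is 0%N then [::] else [:: N].

Definition cell (theta : seq nat) : finType :=
  {i : 'I_(size theta) & 'I_(nth 0%N theta i)}.
Definition cell_row (theta : seq nat) (x : cell theta) : nat := tag x.
Definition cell_col (theta : seq nat) (x : cell theta) : nat := tagged x.

Definition semistandard (theta : seq nat) (m : nat)
    (T : {ffun cell theta -> 'I_m}) : bool :=
  [forall x, forall y,
    ((cell_row x == cell_row y) && (cell_col x < cell_col y)%N
       ==> (T x <= T y)%N)
    && ((cell_col x == cell_col y) && (cell_row x < cell_row y)%N
       ==> (T x < T y)%N)].

Definition has_content (theta : seq nat) (m : nat) (c : 'I_m -> int)
    (T : {ffun cell theta -> 'I_m}) : bool :=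
  [forall k, (#|[set x | T x == k]|)%:Z == c k].

Definition kostka (theta : seq nat) (m : nat) (c : 'I_m -> int) : nat :=
  #|[set T : {ffun cell theta -> 'I_m} | semistandard T && has_content c T]|.

(* mu + delta - w (nu + delta), where delta = (m-1, ..., 1, 0) and
   (w a)_i = a_(w^-1 i); [rev_ord i] has value m - 1 - i. *)
Definition imm_content (m : nat) (mu nu : seq nat) (w : 'S_m) (i : 'I_m) : int :=
  let j := w^-1%g i in
  (nth 0%N mu i + rev_ord i)%N%:Z - (nth 0%N nu j + rev_ord j)%N%:Z.

Definition imm_fun (m : nat) (theta mu nu : seq nat) (w : 'S_m) : algC :=
  let C := (w ^: [set: 'S_m])%g in
  (m`!)%:R / (#|C|)%:R
  * \sum_(w' in C) (kostka theta (imm_content mu nu w'))%:R.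

Fact imm_fun_class (m : nat) (theta mu nu : seq nat) :
  is_class_fun <<[set: 'S_m]%G>>%g [ffun w => imm_fun theta mu nu w].
Proof.
rewrite genGid; apply: intro_class_fun => [x y _ Gy|x]; last by rewrite inE.
by rewrite /imm_fun classGidl.
Qed.

(* Meaningful when m is at least the length of mu/nu and theta is a partition
   of its size. *)
Definition immanant_char (m : nat) (theta mu nu : seq nat)
    : 'CF([set: 'S_m]%G) :=
  Cfun 0 (imm_fun_class m theta mu nu).

Definition stanley_stembridge (m : nat) (phi : 'CF([set: 'S_m]%G)) : Prop :=
  exists alpha beta : seq nat,
    [/\ is_skew alpha beta, (skew_length alpha beta <= m)%N
      & phi = immanant_char m (one_row (skew_size alpha beta)) alpha beta].

Definition nonneg_sum_of_ss (m : nat) (phi : 'CF([set: 'S_m]%G)) : Prop :=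
  exists (k : nat) (a : 'I_k -> nat) (psi : 'I_k -> 'CF([set: 'S_m]%G)),
    (forall i, stanley_stembridge (psi i)) /\ phi = \sum_(i < k) psi i *+ a i.

(* Main.v *)
Require Import Defs.

Set Implicit Arguments.
Unset Strict Implicit.
Unset Printing Implicit Defensive.

Import GRing.Theory Num.Theory.
Local Open Scope ring_scope.

(** Passing from S_m to S_(m+1) is induction of characters, and induction is
    linear.  Suppose that mu/nu has length at most m, and number positions from
    0.  Then mu and nu have the same entry at position m, the last one seen by
    S_(m+1).  At that position the content mu + delta - w (nu + delta) is
    mu_m - (nu + delta)_j, where w j = m.  As nu + delta is strictly decreasing
    with last entry nu_m = mu_m, this is negative when j < m, so that the Kostka
    number vanishes ([kostka_imm_moved]).  When w fixes m, it comes from some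
    u in S_m, and its content is that of u followed by a zero, which leaves the
    Kostka number unchanged ([kostka_imm_lift]).

    Hence the sum over a class C of S_(m+1) that defines Gamma reduces to the
    sum of K_u over the intersection of C with S_m.  This intersection is stable
    under conjugation, so that K_u may be replaced in it by its mean over the
    S_m-class of u ([sum_class_mean]), which is Gamma(u) / m!.  The outcome
    ([imm_fun_succ]) is the Frobenius formula for the character induced from
    S_m: the value at w in C is
    (m+1)! / (|C| m!) times the sum of Gamma(u) over u in S_m lying in C.
    In this formula neither theta nor mu/nu occurs outside Gamma(u), hence any
    linear relation between immanant characters of S_m persists in S_(m+1)
    ([imm_sum_succ]).  The second claim follows by induction on m, starting from
    the length of mu/nu.

    The embedding of S_m in S_(m+1) is [lift_perm ord_max ord_max], and
    [lift ord_max] embeds the first m positions. *)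

Lemma semistandard_lift_max (theta : seq nat) (m : nat)
    (T : {ffun cell theta -> 'I_m}) :
  semistandard [ffun x => lift ord_max (T x)] = semistandard T.
Proof.
apply: eq_forallb => x; apply: eq_forallb => y.
by rewrite !ffunE !lift_max.
Qed.

Lemma has_content_lift_max (theta : seq nat) (m : nat)
    (c : 'I_m.+1 -> int) (T : {ffun cell theta -> 'I_m}) :
  c ord_max = 0 ->
  has_content c [ffun x => lift ord_max (T x)]
    = has_content (fun i => c (lift ord_max i)) T.
Proof.
move=> c0.
have cardT k : #|[set x | [ffun x => lift ord_max (T x)] x == lift ord_max k]|
               = #|[set x | T x == k]|.
  by apply: eq_card => x; rewrite !inE ffunE (inj_eq lift_inj).
apply/forallP/forallP => [cT k | cT k]; first by rewrite -cardT.
case: (unliftP ord_max k) => [j ->|->]; first by rewrite cardT.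
rewrite c0 (_ : [set _ | _] = set0) ?cards0 //.
by apply/setP => x; rewrite !inE ffunE eq_sym (negPf (neq_lift _ _)).
Qed.

(** A letter of multiplicity zero occurs in no tableau; when it is the last
    letter, the tableaux can be read in the smaller alphabet. *)
Lemma kostka_drop0 (theta : seq nat) (m : nat) (c : 'I_m.+1 -> int) :
  c ord_max = 0 -> kostka theta c = kostka theta (fun i => c (lift ord_max i)).
Proof.
move=> c0; pose liftT (T : {ffun cell theta -> 'I_m}) :=
  [ffun x => lift ord_max (T x)].
have liftT_inj : injective liftT.
  move=> T1 T2 /ffunP eqT; apply/ffunP => x.
  by have := eqT x; rewrite !ffunE => /lift_inj.
rewrite /kostka -(card_imset _ liftT_inj); congr #|pred_of_set _|.
apply/setP => T'; apply/idP/imsetP => [| [T + ->]]; last first.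
  by rewrite !inE semistandard_lift_max has_content_lift_max.
rewrite inE => ssT'; have /andP[_ /forallP/(_ ord_max)] := ssT'.
rewrite c0 eqz_nat cards_eq0 => /eqP T'max.
(* The preimage is obtained by choice over the cells, as 'I_m may be empty and
   then offers no default value. *)
have /fin_all_exists[f T'f] x : exists i, T' x = lift ord_max i.
  case: (unliftP ord_max (T' x)) => [i ->|T'x]; first by exists i.
  by have := in_set0 x; rewrite -T'max inE T'x eqxx.
have defT' : T' = liftT (finfun f) by apply/ffunP => x; rewrite !ffunE.
exists (finfun f) => //.
by move: ssT'; rewrite inE defT' semistandard_lift_max has_content_lift_max.
Qed.

Lemma kostka_neg (theta : seq nat) (m : nat) (c : 'I_m -> int) (i : 'I_m) :
  (c i < 0)%R -> kostka theta c = 0%N.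
Proof.
move=> ci_lt0; apply/eqP; rewrite cards_eq0; apply/eqP/setP => T.
rewrite !inE; apply/negbTE/negP => /andP[_ /forallP/(_ i)/eqP ci].
by rewrite -ci in ci_lt0.
Qed.

Lemma partition_nth_le (s : seq nat) (i j : nat) :
  is_partition s -> (i <= j)%N -> (nth 0 s j <= nth 0 s i)%N.
Proof.
move=> /andP[s_dec _] le_ij; have [j_lt|j_ge] := ltnP j (size s); last first.
  by rewrite (nth_default _ j_ge).
have geq_trans : transitive geq by move=> y x z yx xz; apply: leq_trans xz yx.
apply: (sorted_leq_nth geq_trans leqnn 0%N s_dec) => //.
exact: leq_ltn_trans j_lt.
Qed.

(** The length only controls where the two partitions differ: beyond it they
    coincide, possibly with nonzero parts. *)
Lemma nth_skew_length (mu nu : seq nat) (m : nat) :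
  is_skew mu nu -> (skew_length mu nu <= m)%N -> nth 0%N nu m = nth 0%N mu m.
Proof.
move=> [_ _ le_numu] /bigmax_leqP len_le; apply/eqP.
rewrite eqn_leq le_numu /= leqNgt; apply/negP => lt_m.
have m_lt : (m < size mu)%N.
  by rewrite ltnNge; apply: contraL lt_m => /(nth_default 0%N)->.
by have := len_le (Ordinal m_lt) lt_m; rewrite /= ltnn.
Qed.

Lemma lift_max_permP (m : nat) (w : 'S_m.+1) :
  w ord_max = ord_max -> exists u, w = lift_perm ord_max ord_max u.
Proof.
move=> w_max.
have /fin_all_exists[f wf] i : exists j, w (lift ord_max i) = lift ord_max j.
  case: (unliftP ord_max (w (lift ord_max i))) => [j ->|wi]; first by exists j.
  have /perm_inj/eqP : w ord_max = w (lift ord_max i) by rewrite wi.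
  by rewrite (negPf (neq_lift _ _)).
have f_inj : injective f.
  move=> i j eq_f; apply: (@lift_inj _ ord_max); apply: (@perm_inj _ w).
  by rewrite !wf eq_f.
exists (perm f_inj); apply/permP => k.
case: (unliftP ord_max k) => [i ->|->]; last by rewrite lift_perm_id.
by rewrite lift_perm_lift permE wf.
Qed.

Lemma lift_max_perm_inj (m : nat) :
  injective (@lift_perm m ord_max ord_max).
Proof.
move=> u v /permP eq_uv; apply/permP => i; apply: (@lift_inj _ ord_max).
by have := eq_uv (lift ord_max i); rewrite !lift_perm_lift.
Qed.

(** The staircases of S_m and S_(m+1) differ by one in each of the first m
    positions; these shifts cancel between mu + delta and w (nu + delta). *)
Lemma kostka_imm_lift (m : nat) (theta mu nu : seq nat) (u : 'S_m) :
  nth 0%N nu m = nth 0%N mu m ->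
  kostka theta (imm_content mu nu (lift_perm ord_max ord_max u))
    = kostka theta (imm_content mu nu u).
Proof.
move=> eq_m; rewrite kostka_drop0; last first.
  rewrite /imm_content lift_permV lift_perm_id /= eq_m.
  by rewrite subrr.
apply: eq_card => T; rewrite !inE; congr (_ && _).
apply: eq_forallb => i; congr (_ == _).
rewrite /imm_content lift_permV lift_perm_lift.
have rev_lift (j : 'I_m) :
    (rev_ord (lift ord_max j : 'I_m.+1)) = (rev_ord j).+1 :> nat.
  by rewrite /= /bump leqNgt ltn_ord subSS subnSK.
by rewrite !rev_lift !lift_max !addnS !intS opprD addrACA subrr add0r.
Qed.

(** Since nu + delta is strictly decreasing and its last entry is mu_m, any
    other entry moved to the last position exceeds mu_m. *)
Lemma kostka_imm_moved (m : nat) (theta mu nu : seq nat) (w : 'S_m.+1) :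
  is_partition nu -> nth 0%N nu m = nth 0%N mu m -> w ord_max != ord_max ->
  kostka theta (imm_content mu nu w) = 0%N.
Proof.
move=> nu_part eq_m w_max; apply: (@kostka_neg _ _ _ ord_max).
rewrite /imm_content; set j := (w^-1)%g ord_max.
have j_lt : (j < m)%N.
  have := ltn_ord j; rewrite ltnS leq_eqVlt => /orP[/eqP j_max|//].
  by case/eqP: w_max; rewrite -{1}(_ : j = ord_max) ?permKV //; apply: val_inj.
rewrite subr_lt0 ltz_nat.
rewrite /= -eq_m subnn addn0 (leq_ltn_trans (partition_nth_le _ (ltnW j_lt))) //.
by rewrite -[X in (X < _)%N]addn0 ltn_add2l subn_gt0.
Qed.

(** Averaging over classes preserves the sum over a set that is a union of
    classes: once the two summations are exchanged, each y of A is counted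
    |y ^: G| times with weight 1 / |y ^: G|. *)
Lemma sum_class_mean (gT : finGroupType) (G : {group gT}) (A : {set gT})
    (f : gT -> algC) :
  {in A, forall x, x ^: G \subset A}%g ->
  \sum_(x in A) f x
    = \sum_(x in A) #|(x ^: G)%g|%:R^-1 * \sum_(y in (x ^: G)%g) f y.
Proof.
move=> clA; under [RHS]eq_bigr do rewrite big_distrr /=.
rewrite (exchange_big_dep [in A]) /= => [|x y Ax xy]; last first.
  exact: subsetP (clA x Ax) y xy.
apply: eq_bigr => y Ay.
have classE x : (x \in A) && (y \in x ^: G)%g = (x \in y ^: G)%g.
  rewrite class_sym andb_idl // => yx; exact: subsetP (clA y Ay) x yx.
rewrite (eq_bigl _ _ classE).
under eq_bigr => x /class_eqP-> do [].
rewrite sumr_const -[RHS]mulr_natr mulrAC mulVf ?mul1r //.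
by rewrite pnatr_eq0 -lt0n card_gt0; apply/set0Pn; exists y; apply: class_refl.
Qed.

(** Frobenius' formula for induction from S_m to S_(m+1). What matters is that
    the right-hand side is linear in the immanant character of S_m, with
    coefficients depending on w alone. *)
Lemma imm_fun_succ (m : nat) (theta mu nu : seq nat) (w : 'S_m.+1) :
  is_skew mu nu -> (skew_length mu nu <= m)%N ->
  imm_fun theta mu nu w =
    m.+1`!%:R / #|(w ^: [set: 'S_m.+1])%g|%:R
    * ((m`!)%:R^-1 * \sum_(u : 'S_m | lift_perm ord_max ord_max u
                                         \in (w ^: [set: 'S_m.+1])%g)
                        imm_fun theta mu nu u).
Proof.
move=> skew len; have eq_m := nth_skew_length skew len.
have [_ nu_part _] := skew.
rewrite /imm_fun; congr (_ * _).
pose A := [set u : 'S_m | lift_perm ord_max ord_max u \in w ^: [set: 'S_m.+1]]%g.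
rewrite (bigID [pred w' : 'S_m.+1 | w' ord_max == ord_max]) /=.
rewrite [X in _ + X]big1 ?addr0 => [|w' /andP[_ w'_max]]; last first.
  by rewrite kostka_imm_moved.
transitivity (\sum_(u in A) (kostka theta (imm_content mu nu u))%:R : algC).
  under [RHS]eq_bigr => u _ do rewrite -(kostka_imm_lift theta _ eq_m).
  rewrite -(big_imset (fun w' => (kostka theta (imm_content mu nu w'))%:R : algC)
             (in2W (@lift_max_perm_inj m))).
  apply: eq_bigl => w'; apply/andP/imsetP => [[w'C /eqP/lift_max_permP[u def_w']]|].
    by exists u; rewrite // inE -def_w'.
  by move=> [u + ->]; rewrite inE lift_perm_id.
(* S_m-conjugate elements stay conjugate in S_(m+1), so A is a union of classes. *)
rewrite (@sum_class_mean _ [set: 'S_m]%G) //; last first.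
  move=> u; rewrite inE => uC; apply/subsetP => _ /imsetP[v _ ->].
  rewrite inE conjgE -!(@lift_permM _ _ ord_max) -lift_permV -conjgE.
  by apply: class_trans uC; rewrite memJ_class ?inE.
rewrite big_distrr /=; apply: eq_big => u; rewrite ?inE // => _.
by rewrite !mulrA mulVf ?mul1r // pnatr_eq0 -lt0n fact_gt0.
Qed.

(** The shapes thetas are arbitrary because the one-row shapes of a
    Stanley-Stembridge decomposition need not all have the size of theta. *)
Lemma imm_sum_succ (m k : nat) (a : 'I_k -> nat) (theta mu nu : seq nat)
    (thetas mus nus : 'I_k -> seq nat) :
  is_skew mu nu -> (skew_length mu nu <= m)%N ->
  (forall i, is_skew (mus i) (nus i)
             /\ (skew_length (mus i) (nus i) <= m)%N) ->
  immanant_char m theta mu nu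
    = \sum_(i < k) immanant_char m (thetas i) (mus i) (nus i) *+ a i ->
  immanant_char m.+1 theta mu nu
    = \sum_(i < k) immanant_char m.+1 (thetas i) (mus i) (nus i) *+ a i.
Proof.
have immE p t al be (w : 'S_p) : immanant_char p t al be w = imm_fun t al be w.
  exact: cfunE.
move=> skew len skews eq_m; apply/cfunP => w.
rewrite sum_cfunE immE imm_fun_succ //.
under [RHS]eq_bigr => i _.
  have [sk ln] := skews i; rewrite muln_cfunE immE imm_fun_succ //
    -!mulrnAr -sumrMnl.
  over.
rewrite -!big_distrr exchange_big /=; congr (_ * (_ * _)).
apply: eq_bigr => u _; rewrite -immE eq_m sum_cfunE.
by apply: eq_bigr => i _; rewrite muln_cfunE immE.
Qed.

Theorem proposition3p2 :
  (forall (n : nat) (mu nu theta : seq nat) (k : nat)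
          (mus nus : 'I_k -> seq nat),
     (0 < n)%N ->
     is_skew mu nu -> (skew_length mu nu <= n.-1)%N ->
     partition_of (skew_size mu nu) theta ->
     (forall i, [/\ is_skew (mus i) (nus i),
                    skew_size (mus i) (nus i) = skew_size mu nu
                  & (skew_length (mus i) (nus i) <= n.-1)%N]) ->
     immanant_char n.-1 theta mu nu
       = \sum_(i < k)
           immanant_char n.-1 (one_row (skew_size mu nu)) (mus i) (nus i) ->
     immanant_char n theta mu nu
       = \sum_(i < k)
           immanant_char n (one_row (skew_size mu nu)) (mus i) (nus i))
  /\
  ((forall mu nu theta : seq nat,
      is_skew mu nu -> partition_of (skew_size mu nu) theta ->
      nonneg_sum_of_ss
        (immanant_char (skew_length mu nu) theta mu nu)) ->
   forall (mu nu theta : seq nat) (m : nat),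
     is_skew mu nu -> partition_of (skew_size mu nu) theta ->
     (skew_length mu nu <= m)%N ->
     nonneg_sum_of_ss (immanant_char m theta mu nu)).
Proof.
split=> [[//|m] mu nu theta k mus nus _ skew len _ skews eq_m|].
  apply: (@imm_sum_succ m k (fun=> 1%N) theta mu nu
            (fun=> one_row (skew_size mu nu))) => // i.
  by have [] := skews i.
move=> base mu nu theta m skew theta_part.
elim: m => [|m IHm] len.
  by have := base mu nu theta skew theta_part; move: len; rewrite leqn0 => /eqP->.
move: len; rewrite leq_eqVlt => /predU1P[<-|]; first exact: base.
rewrite ltnS => len; have [k [a [psi [ss_psi eq_m]]]] := IHm len.
have /fin_all_exists[al /fin_all_exists[be abP]] := ss_psi.
exists k, a, (fun i => immanant_char m.+1 (one_row (skew_size (al i) (be i)))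
                         (al i) (be i)); split=> [i|].
  by have [sk ln _] := abP i; exists (al i), (be i); split=> //; apply: leqW.
apply: imm_sum_succ => // [i|]; first by have [] := abP i.
by rewrite eq_m; apply: eq_bigr => i _; have [_ _ <-] := abP i.
Qed.
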